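(* Let $H$ be Hall's universal group. (a) Let $G$ be a finite group such that $D_{2m} \le G$ for some positive integer $m$. Then $T(G,H) = \infty$. (b) Let $G$ be a finite group. If $C_2 \times C_2 \le G$, then $T(G,H) = \infty$. (c) If $A = C_{n_1} \times \dots \times C_{n_k}$ is a finite abelian group such that at least two of the integers $n_1,\dots,n_k$ are even, then $T(A,H) = \infty$. (d) $T(S_n, H) = \infty$ for all $n \ge 3$, where $S_n$ denotes the symmetric group.
   Context: Hall's universal group $H$ is the Fraïssé limit of the class of all finite groups: the (unique up to isomorphism) countable locally finite group that embeds every finite group and in which every isomorphism between two finite subgroups extends to an automorphism of $H$. For a positive integer $n$, $D_n$ denotes the dihedral group with $2n$ elements (so $D_{2m}$ has $4m$ elements, and $D_2 \cong C_2 \times C_2$), and $C_n$ denotes the cyclic group of order $n$. For groups, $K \le G$ means that $G$ has a subgroup isomorphic to $K$. For first-order structures $A, B$ of the same signature, $\mathrm{Emb}(A,B)$ denotes the set of all embeddings $A \hookrightarrow B$ (for groups: injective homomorphisms). Let $A$ be a finite structure and $S$ a locally finite structure. The big Ramsey degree $T(A,S)$ of $A$ in $S$ is the least positive integer $n$, if it exists, such that for every positive integer $k$ and every coloring $\chi : \mathrm{Emb}(A,S) \to \{0,\dots,k-1\}$ there is $w \in \mathrm{Emb}(S,S)$ with $|\chi(w \circ \mathrm{Emb}(A,S))| \le n$, where $w \circ \mathrm{Emb}(A,S) = \{w \circ f : f \in \mathrm{Emb}(A,S)\}$. If no such $n$ exists, write $T(A,S) = \infty$. *)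

(* Defs.v *)
From HB Require Import structures.
From mathcomp Require Import all_boot all_fingroup zmodp all_solvable.
From mathcomp Require Import boolp classical_sets functions cardinality.

Set Implicit Arguments.
Unset Strict Implicit.
Unset Printing Implicit Defensive.

Local Open Scope classical_set_scope.
Local Open Scope card_scope.
Local Open Scope group_scope.

Record emb (A B : groupType) := Emb {
  emb_fun :> {multiplicative A -> B};
  emb_inj : injective emb_fun }.

Definition emb_comp (A B C : groupType) (w : emb B C) (f : emb A B) : emb A C :=
  @Emb A C (emb_fun w \o emb_fun f) (inj_comp (@emb_inj _ _ w) (@emb_inj _ _ f)).

Definition ramsey_bound (A S : groupType) (n : nat) : Prop :=
  forall (k : nat) (chi : emb A S -> 'I_k), (0 < k)%N ->
    exists w : emb S S, range (fun f : emb A S => chi (emb_comp w f)) #<= `I_n.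

Definition is_least_ramsey_bound (A S : groupType) (n : nat) : Prop :=
  [/\ (0 < n)%N, ramsey_bound A S n
    & forall m : nat, (0 < m)%N -> ramsey_bound A S m -> (n <= m)%N].

(* The value [None] stands for infinity. *)
Definition big_ramsey_degree (A S : groupType) : option nat :=
  xget None [set t : option nat |
    exists2 n : nat, is_least_ramsey_bound A S n & t = Some n].

Definition subgroup_set (H : groupType) (K : set H) : Prop :=
  [/\ K 1, forall x y, K x -> K y -> K (x * y) & forall x, K x -> K x^-1].

Definition generated (H : groupType) (X : set H) : set H :=
  \bigcap_(K in [set K : set H | subgroup_set K /\ X `<=` K]) K.

Definition locally_finite (H : groupType) : Prop :=
  forall X : set H, finite_set X -> finite_set (generated X).

(* An isomorphism between the subgroups [K] and [L] is given by a map
   [phi : H -> H], whose values outside [K] are irrelevant. *)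
Definition ultrahomogeneous (H : groupType) : Prop :=
  forall (K L : set H) (phi : H -> H),
    subgroup_set K -> finite_set K -> subgroup_set L -> finite_set L ->
    set_bij K L phi ->
    (forall x y, K x -> K y -> phi (x * y) = phi x * phi y) ->
    exists2 sigma : {multiplicative H -> H},
      bijective sigma & forall x, K x -> sigma x = phi x.

Definition hall_universal (H : groupType) : Prop :=
  [/\ countable [set: H], locally_finite H,
      forall G : finGroupType, inhabited (emb G H)
    & ultrahomogeneous H].

Definition embeds_in (gT : finGroupType) (K : {group gT}) (G : finGroupType) : Prop :=
  exists L : {group G}, L \isog K.

(* Main.v *)
Require Import Defs.
From HB Require Import structures.
From mathcomp Require Import all_boot all_fingroup zmodp all_solvable.
From mathcomp Require Import boolp classical_sets functions cardinality filter.

(** All four parts follow from one fact: if a finite group [G] has two distinct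
    involutions [a] and [b], then no finite number bounds the big Ramsey degree
    of [G] in Hall's group [H].

    The colouring.  Exhaust [H] by an increasing sequence of finite subgroups
    [H_n] and choose a representative [r_n(x)] of each left coset [x H_n].
    The digits [r_(n+1)(x)^-1 * r_n(x)] determine [x], the [n]-th digit depends
    only on [x H_n], and it takes finitely many values.  Compare the digits of
    [x] and [y] at every place where they differ; [osc x y] is the number of
    changes in the resulting sequence of signs.  An embedding [f] of [G] gets
    the colour [osc (f a) (f b)] modulo [k].

    The pool.  The group of eventually constant sequences in [G] is a union of
    finite powers of [G], so by universality and homogeneity it embeds in [H]
    ([sequence_embedding]).  The constant sequence [a] and the sequences with a
    single entry [a * b] give elements [tau] and [u_0], [u_1], ... of [H] such
    that the [u_i] commute and, for disjoint finite sets [I] and [J] with [I]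
    nonempty, the elements [x = u_I * tau] and [y = u_J * tau] are involutions
    whose product has the same order as [a * b] ([involution_pool]).  Here [u_I]
    is the product of the [u_i] with [i] in [I].  Two involutions are determined
    up to isomorphism by the order of their product, so homogeneity yields an
    embedding of [G] in [H] that maps [(a, b)] to [(x, y)]
    ([homogeneous_involutions]).

    The oscillation.  Let [w] embed [H] in itself and put [v_i = w (u_i)].  Fix
    a nonprincipal ultrafilter on the indices, and let the limit digits of [z]
    be the iterated limits of the digits of
    [z * v_(i_1) * ... * v_(i_s) * w tau].  One chooses pairs of indices
    [(i_1, j_1)], [(i_2, j_2)], ..., each far beyond the preceding ones and so
    deep in the ultrafilter that the digits below a suitable level already have
    their limit values.  Then the places split into consecutive blocks, one for
    each pair.  In the [m]-th block the digits of a word depend only on which of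
    [i_m] and [j_m] it contains.  Give one of them to [I] and the other to [J]:
    the two choices produce opposite, nonempty sign sequences in that block.  So
    one can choose freely whether the sign changes at the border of two
    consecutive blocks, and [s] pairs realise [s] consecutive values of [osc]
    ([interleaved_words]).  With [s = k] every colour occurs on the image of
    [w], and [k] was arbitrary. *)

Set Implicit Arguments.
Unset Strict Implicit.
Unset Printing Implicit Defensive.

Local Open Scope group_scope.
Local Open Scope card_scope.
Local Open Scope classical_set_scope.

(** * Multiplicative maps and extension of embeddings *)

Section Multiplicative.
Variables (A B : groupType) (f : {multiplicative A -> B}).

Lemma multiplicativeM x y : f (x * y) = f x * f y.
Proof. exact: gmulfM. Qed.

Lemma multiplicative1 : f 1 = 1.
Proof. by apply: (mulgI (f 1)); rewrite -multiplicativeM !mulg1. Qed.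

Lemma multiplicativeV x : f x^-1 = (f x)^-1.
Proof.
by apply: (mulgI (f x)); rewrite -multiplicativeM !mulgV multiplicative1.
Qed.

Lemma multiplicativeX x n : f (x ^+ n) = f x ^+ n.
Proof.
elim: n => [|n IH]; first by rewrite !expg0 multiplicative1.
by rewrite !expgS multiplicativeM IH.
Qed.

Lemma multiplicative_prod (s : seq nat) (u : nat -> A) :
  f (\prod_(i <- s) u i) = \prod_(i <- s) f (u i).
Proof.
elim: s => [|i s IH]; first by rewrite !big_nil multiplicative1.
by rewrite !big_cons multiplicativeM IH.
Qed.

End Multiplicative.

(** Any two embeddings of a finite group in a homogeneous group differ by an
    automorphism. *)
Lemma homogeneous_emb (H : groupType) (A : finGroupType) (f g : emb A H) :
  ultrahomogeneous H ->
  exists2 sigma : {multiplicative H -> H},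
    bijective sigma & forall x, sigma (f x) = g x.
Proof.
move=> hH.
have rangeP (h : emb A H) : subgroup_set (range h).
  split.
  - by exists 1 => //; rewrite multiplicative1.
  - by move=> _ _ [x _ <-] [y _ <-]; exists (x * y); rewrite ?multiplicativeM.
  - by move=> _ [x _ <-]; exists x^-1; rewrite ?multiplicativeV.
have finP (h : emb A H) : finite_set (range h) by apply: finite_image; exact: finite_finset.
pose phi (y : H) : H := g (xget 1 [set x | f x = y]).
have phiE x : phi (f x) = g x.
  rewrite /phi; congr (emb_fun g _).
  by apply: xget_unique => // y; exact: (@emb_inj _ _ f).
have [||sigma sbij sE] := hH (range f) (range g) phi (rangeP f) (finP f) (rangeP g) (finP g).
- split.
  + by move=> _ [x _ <-] /=; rewrite phiE; exists x.
  + move=> _ _ /set_mem [x _ <-] /set_mem [y _ <-].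
    by rewrite !phiE => e; rewrite (@emb_inj _ _ g _ _ e).
  + by move=> _ [x _ <-]; exists (f x); [exists x | rewrite phiE].
- move=> _ _ [x _ <-] [y _ <-].
  by rewrite -multiplicativeM !phiE multiplicativeM.
by exists sigma => // x; rewrite sE ?phiE //; exists x.
Qed.

(** * Pairs of involutions *)

(** An element of order two. *)
Definition involution (G : groupType) (x : G) : Prop := x * x = 1 /\ x <> 1.

(** The element [(a * b)^k] or [(a * b)^k * a] encoded by [w = (k, e)].  When [a]
    and [b] are involutions, these elements form the dihedral group that they
    generate. *)
Definition dih (G : groupType) (a b : G) (w : nat * bool) : G :=
  (a * b) ^+ w.1 * (if w.2 then a else 1).

(** The product of two such codes when [(a * b)^p = 1]; the exponent
    [p.-1 * l] stands for [- l]. *)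
Definition dih_mul (p : nat) (w w' : nat * bool) : nat * bool :=
  ((w.1 + (if w.2 then p.-1 * w'.1 else w'.1))%N, w.2 (+) w'.2).

Lemma involutionV (G : groupType) (x : G) : involution x -> x^-1 = x.
Proof. by case=> xx _; apply: (mulgI x); rewrite mulgV xx. Qed.

(** Indeed [(a * b)^k * a] is a conjugate of [a] or [b]. *)
Lemma dih_refl_neq1 (G : groupType) (a b : G) k :
  involution a -> involution b -> (a * b) ^+ k * a <> 1.
Proof.
elim: k a b => [|k IH] a b ha hb; first by rewrite expg0 mul1g; case: ha.
have shift n : (a * b) ^+ n * a = a * (b * a) ^+ n.
  elim: n => [|n IHn]; first by rewrite !expg0 mul1g mulg1.
  by rewrite expgS -mulgA IHn expgS !mulgA.
rewrite shift expgSr => /(congr1 (fun x => a^-1 * x * a)).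
rewrite mulg1 mulVg mulKg => e.
by apply: (IH b a hb ha); move: e; rewrite mulgA -[X in X = 1]mulgA ha.1 mulg1.
Qed.

Section DihedralPair.
Variables (G : groupType) (a b : G) (p : nat).
Hypotheses (ha : involution a) (hb : involution b).
Hypotheses (p_gt0 : (0 < p)%N) (abp : (a * b) ^+ p = 1).

Let c := a * b.

Let cV n : (c ^+ n)^-1 = c ^+ (p.-1 * n).
Proof.
apply: (mulgI (c ^+ n)); rewrite mulgV -expgnDr.
by rewrite -[X in (X + _)%N]mul1n -mulnDl add1n prednK // expgnA abp expg1n.
Qed.

Let ac n : a * c ^+ n = c ^+ (p.-1 * n) * a.
Proof.
rewrite -cV; elim: n => [|n IH]; first by rewrite expg0 invg1 mul1g mulg1.
rewrite {1}expgSr mulgA IH -mulgA expgS invgM -!mulgA; congr (_ * _).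
by rewrite /c invgM (involutionV ha) (involutionV hb) mulgA ha.1 -mulgA ha.1 mul1g mulg1.
Qed.

Lemma dihM w w' : dih a b w * dih a b w' = dih a b (dih_mul p w w').
Proof.
case: w w' => [k e] [l f]; rewrite /dih /dih_mul /= -/c expgnDr -!mulgA.
congr (_ * _); case: e; rewrite /= ?mul1g //.
rewrite mulgA ac -mulgA; congr (_ * _).
by case: f; rewrite /= ?mulg1 // ha.1.
Qed.

Lemma dih1 : dih a b (0, false) = 1.
Proof. by rewrite /dih expg0 mulg1. Qed.

Lemma dih_eq w w' :
  dih a b w = dih a b w' <-> w.2 = w'.2 /\ c ^+ w.1 = c ^+ w'.1.
Proof.
have neq k l : c ^+ k * a <> c ^+ l.
  move=> /(congr1 (fun x => (c ^+ l)^-1 * x)); rewrite mulVg mulgA cV -expgnDr.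
  exact: dih_refl_neq1.
case: w w' => [k e] [l f]; rewrite /dih /= -/c; split=> [|[-> ->]] //.
case: e f => [] []; rewrite ?mulg1.
- by move/mulIg.
- by move/neq.
- by move/esym/neq.
- by [].
Qed.

Lemma dih_range_subgroup : subgroup_set (range (dih a b)).
Proof.
split.
- by exists (0, false); rewrite ?dih1.
- by move=> _ _ [w _ <-] [w' _ <-]; rewrite dihM; exists (dih_mul p w w').
- move=> _ [[k []] _ <-].
    exists (k, true) => //; apply: (mulgI (dih a b (k, true))).
    rewrite mulgV dihM /dih_mul /= /dih /= mulg1 -/c.
    by rewrite expgnDr -cV mulgV.
  by exists (p.-1 * k, false)%N; rewrite // /dih /= !mulg1 -/c cV.
Qed.

Lemma dih_range_finite : finite_set (range (dih a b)).
Proof.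
apply: (@sub_finite_set _ _ (range (fun w : 'I_p * bool => dih a b (w.1 : nat, w.2)))).
  move=> _ [[k e] _ <-]; exists (Ordinal (ltn_pmod k p_gt0), e) => //=.
  rewrite /dih /= -/c [in RHS](divn_eq k p) expgnDr mulnC expgnA.
  by rewrite abp expg1n mul1g.
by apply: finite_image; exact: finite_finset.
Qed.

End DihedralPair.

(** The codes identify the groups generated by [a, b] and by [a', b'], as the
    powers of [a * b] and [a' * b'] satisfy the same equations. *)
Lemma homogeneous_involutions (H : groupType) (a b a' b' : H) (p : nat) :
  ultrahomogeneous H ->
  involution a -> involution b -> involution a' -> involution b' ->
  (0 < p)%N -> (a * b) ^+ p = 1 ->
  (forall k, (a * b) ^+ k = 1 <-> (a' * b') ^+ k = 1) ->
  exists sigma : {multiplicative H -> H},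
    [/\ bijective sigma, sigma a = a' & sigma b = b'].
Proof.
move=> hH ha hb ha' hb' p0 abp abE.
have abp' : (a' * b') ^+ p = 1 by apply/abE.
have powE k l : (a * b) ^+ k = (a * b) ^+ l <-> (a' * b') ^+ k = (a' * b') ^+ l.
  have sub (x : H) m n : (m <= n)%N -> x ^+ m = x ^+ n <-> x ^+ (n - m) = 1.
    move=> mn; rewrite expgnFr //; split=> [->|]; first by rewrite mulgV.
    by move/divg1_eq.
  case: (leqP k l) => [kl|/ltnW lk]; first by rewrite !sub.
  by split=> /esym e; apply/esym; move: e; rewrite !sub // => /abE.
have dihE w w' : dih a b w = dih a b w' <-> dih a' b' w = dih a' b' w'.
  rewrite (dih_eq ha hb p0 abp) (dih_eq ha' hb' p0 abp').
  by split=> -[-> /powE].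
pose phi (y : H) : H := dih a' b' (xget (0, false) [set w | dih a b w = y]).
have phiE w : phi (dih a b w) = dih a' b' w.
  by apply/dihE; apply: (@xgetI _ (0, false) [set w' | dih a b w' = dih a b w] w).
have [||sigma sbij sE] := hH (range (dih a b)) (range (dih a' b')) phi
  (dih_range_subgroup ha hb p0 abp) (dih_range_finite p0 abp)
  (dih_range_subgroup ha' hb' p0 abp') (dih_range_finite p0 abp').
- split.
  + by move=> _ [w _ <-] /=; rewrite phiE; exists w.
  + move=> _ _ /set_mem [w _ <-] /set_mem [w' _ <-].
    by rewrite !phiE => /dihE.
  + by move=> _ [w _ <-]; exists (dih a b w); [exists w | rewrite phiE].
- move=> _ _ [w _ <-] [w' _ <-].
  by rewrite (dihM ha hb p0 abp) !phiE (dihM ha' hb' p0 abp').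
have sdih w : sigma (dih a b w) = dih a' b' w by rewrite sE ?phiE //; exists w.
have sa : sigma a = a' by have := sdih (0, true); rewrite /dih /= !expg0 !mul1g.
exists sigma; split=> //; have := sdih (1%N, false).
by rewrite /dih /= !mulg1 !expg1 multiplicativeM sa => /mulgI.
Qed.

(** * Eventually constant sequences in Hall's group *)

Section FinitePower.
Variable G : finGroupType.

(** The power of [G] with index set [{0, ..., M}].  Its elements stand for the
    sequences that are constant from the index [M] on. *)
Definition power (M : nat) : finGroupType := {dffun forall i : 'I_M.+1, G}.

(** The [t]-th term of the sequence encoded by [x]. *)
Definition coord (M : nat) (x : power M) (t : nat) : G := x (inord (minn t M)).

(** The first [M + 1] terms of a sequence. *)
Definition truncate (M : nat) (f : nat -> G) : power M :=
  [ffun i : 'I_M.+1 => f i].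

Lemma coordM M (x y : power M) t : coord (x * y) t = coord x t * coord y t.
Proof. by rewrite /coord ffunE. Qed.

Lemma coord_truncate M f t : coord (truncate M f) t = f (minn t M).
Proof. by rewrite /coord ffunE inordK // ltnS geq_minr. Qed.

Lemma truncate_coord M (x : power M) : truncate M (coord x) = x.
Proof.
apply/ffunP => i; rewrite ffunE /coord; congr (fun_of_fin x _).
apply: val_inj => /=; have iM : (i <= M)%N by rewrite -ltnS.
by rewrite (minn_idPl iM) inordK.
Qed.

Lemma truncateM M f g :
  truncate M (fun t => f t * g t) = truncate M f * truncate M g.
Proof. by apply/ffunP => i; rewrite !ffunE. Qed.

(** The inclusion of the sequences constant from [M] on among those constant
    from [M + 1] on: the last coordinate is repeated. *)
Definition extend (M : nat) (x : power M) : power M.+1 :=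
  truncate M.+1 (coord x).

Lemma extend_truncate M f :
  f M.+1 = f M -> extend (truncate M f) = truncate M.+1 f.
Proof.
move=> fM; apply/ffunP => i; rewrite !ffunE coord_truncate.
case: (leqP i M) => [//|iM].
rewrite -fM; congr (f _).
by apply/eqP; rewrite eqn_leq iM -ltnS ltn_ord.
Qed.

Fact extendM M : {morph @extend M : x y / x * y}.
Proof.
by move=> x y; rewrite -truncateM; apply/ffunP => i; rewrite !ffunE coordM.
Qed.

HB.instance Definition _ M := isMultiplicative.Build _ _ (@extend M) (@extendM M).

Lemma extend_inj M : injective (@extend M).
Proof.
move=> x y e; rewrite -[x]truncate_coord -[y]truncate_coord; apply/ffunP => i.
have iM : (i < M.+2)%N by apply: ltnW; rewrite ltnS.
have := congr1 (fun z : power M.+1 => z (Ordinal iM)) e.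
by rewrite !ffunE.
Qed.

Definition extend_emb M : emb (power M) (power M.+1) :=
  @Emb (power M) (power M.+1) (@extend M) (@extend_inj M).

End FinitePower.

(** The sequence [f] is constant from the index [M] on. *)
Definition eventually_constant (T : Type) (f : nat -> T) (M : nat) : Prop :=
  forall t, (M <= t)%N -> f t = f M.

Lemma eventually_constant_le (T : Type) (f : nat -> T) M N :
  eventually_constant f M -> (M <= N)%N -> eventually_constant f N.
Proof. by move=> fM MN t Nt; rewrite fM ?(leq_trans MN) // [RHS]fM. Qed.

Section CompatibleEmbeddings.
Variables (H : groupType) (G : finGroupType).
Hypothesis hH : hall_universal H.

Lemma extend_step M (e : emb (power G M) H) :
  {e' : emb (power G M.+1) H | forall x, e' (extend x) = e x}.
Proof.
apply: cid; have [_ _ univ homog] := hH.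
have [e0] := univ (power G M.+1).
have [sigma /bij_inj sinj sE] :=
  homogeneous_emb (emb_comp e0 (extend_emb G M)) e homog.
have inj : injective (sigma \o e0) by apply: inj_comp => //; exact: emb_inj.
by exists (@Emb _ _ (sigma \o e0 : {multiplicative power G M.+1 -> H}) inj).
Qed.

(** The finite powers of [G] embed in [H] compatibly with their inclusions. *)
Lemma power_embeddings :
  exists e : forall M, emb (power G M) H,
    forall M x, e M.+1 (extend x) = e M x.
Proof.
have [_ _ univ _] := hH; have [e0] := univ (power G 0).
pose e := fix e M : emb (power G M) H :=
  if M is M'.+1 then sval (extend_step (e M')) else e0.
by exists e => M x /=; case: extend_step.
Qed.

(** The union of these embeddings.  It is given as a total map on sequences whose
    values off the eventually constant ones are irrelevant. *)
Lemma sequence_embedding :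
  exists E : (nat -> G) -> H,
    (forall f g M, eventually_constant f M -> eventually_constant g M ->
       E (fun t => f t * g t) = E f * E g) /\
    (forall f g M, eventually_constant f M -> eventually_constant g M ->
       E f = E g -> f = g).
Proof.
have [e eE] := power_embeddings.
have eD f M k : eventually_constant f M ->
    e (M + k)%N (truncate (M + k) f) = e M (truncate M f).
  move=> fM; elim: k => [|k IH]; first by rewrite addn0.
  rewrite addnS -IH -[RHS]eE extend_truncate //.
  by rewrite (fM (M + k).+1) ?(fM (M + k)%N) ?leq_addr // -addnS leq_addr.
pose E f := match pselect (exists M, eventually_constant f M) with
  | left exM => e (xget 0 [set M | eventually_constant f M])
                  (truncate _ f)
  | right _ => 1 end.
have EE f M : eventually_constant f M -> E f = e M (truncate M f).
  move=> fM; rewrite /E; case: pselect => [exM|[]]; last by exists M.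
  have := xgetPex 0%N exM; set N := xget _ _ => /= fN.
  by rewrite -(eD f N M) // -(eD f M N) // addnC.
exists E; split=> f g M fM gM.
  rewrite !(EE _ M) // ?truncateM ?multiplicativeM // => t Mt.
  by rewrite fM // gM.
rewrite !(EE _ M) // => /(@emb_inj _ _ (e M)) fg; apply: funext => t.
have coordE h : eventually_constant h M -> h t = coord (truncate M h) t.
  move=> hM; rewrite coord_truncate; case: (leqP t M) => // /ltnW Mt.
  exact: hM.
by rewrite coordE // fg -coordE.
Qed.

End CompatibleEmbeddings.

(** The pool is made of the sequences [u i] with [a * b] at [i] and [1] elsewhere,
    and of the constant sequence [tau] with value [a].  The product of the [I]-word
    and the [J]-word is then [a * b] on [I], its inverse on [J], and [1]
    elsewhere. *)
Lemma involution_pool (H : groupType) (G : finGroupType) (a b : G) :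
  hall_universal H -> involution a -> involution b -> a <> b ->
  exists (u : nat -> H) (tau : H),
    [/\ injective u, forall i j, commute (u i) (u j),
        forall I : seq nat, uniq I -> involution (\prod_(i <- I) u i * tau)
      & forall I J : seq nat, uniq (I ++ J) -> (0 < size I)%N ->
          forall k, ((\prod_(i <- I) u i * tau) * (\prod_(j <- J) u j * tau)) ^+ k = 1
                    <-> (a * b) ^+ k = 1].
Proof.
move=> hH ha hb ab; have [E [EM Einj]] := sequence_embedding G hH.
have cst_ec (x : G) : eventually_constant (fun=> x) 0 by [].
have E1 : E (fun=> 1) = 1.
  apply: (mulgI (E (fun=> 1))); rewrite mulg1 -(EM _ _ 0%N) //.
  by congr E; apply: funext => t; rewrite mulg1.
pose ind (x : G) (I : seq nat) t := if t \in I then x else 1.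
have ind_ec x I : exists M, eventually_constant (ind x I) M.
  exists (\max_(i <- I) i.+1) => t; rewrite /ind => It.
  have notin s : (\max_(i <- I) i.+1 <= s)%N -> s \in I = false.
    move=> Is; apply/negP => sI.
    have := leq_trans (@leq_bigmax_seq _ I xpredT (fun i => i.+1) s sI isT) Is.
    by rewrite ltnn.
  by rewrite !notin.
have EM' f g : (exists M, eventually_constant f M) ->
    (exists M, eventually_constant g M) -> E (fun t => f t * g t) = E f * E g.
  move=> [M fM] [N gN]; apply: (EM _ _ (maxn M N)).
    by apply: eventually_constant_le fM _; rewrite leq_maxl.
  by apply: eventually_constant_le gN _; rewrite leq_maxr.
have Einj' f g : (exists M, eventually_constant f M) ->
    (exists M, eventually_constant g M) -> E f = E g -> f = g.
  move=> [M fM] [N gN]; apply: (Einj _ _ (maxn M N)).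
    by apply: eventually_constant_le fM _; rewrite leq_maxl.
  by apply: eventually_constant_le gN _; rewrite leq_maxr.
have ecM f g : (exists M, eventually_constant f M) ->
    (exists M, eventually_constant g M) ->
    exists M, eventually_constant (fun t => f t * g t) M.
  move=> [M fM] [N gN]; exists (maxn M N) => t.
  rewrite geq_max => /andP[Mt Nt]; rewrite fM // gN //.
  by rewrite (fM (maxn M N)) ?leq_maxl // (gN (maxn M N)) ?leq_maxr.
have cst_ec' x : exists M, eventually_constant (fun=> x : G) M by exists 0%N.
pose c := a * b.
have c1 : c <> 1.
  by move=> /mulg1_eq; rewrite (involutionV ha).
have ind_ec' I : exists M, eventually_constant (fun t => ind c I t * a) M.
  exact: ecM.
pose u i := E (ind c [:: i]); pose tau := E (fun=> a).
have prodE I : uniq I -> \prod_(i <- I) u i = E (ind c I).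
  elim: I => [_|i I IH /= /andP[iI uI]]; first by rewrite big_nil -E1.
  rewrite big_cons IH // -EM' //; congr E; apply: funext => t.
  rewrite /ind !inE; case: eqP => [->|_]; last by rewrite mul1g.
  by rewrite (negPf iI) mulg1.
have seqE I : uniq I -> \prod_(i <- I) u i * tau = E (fun t => ind c I t * a).
  by move=> uI; rewrite prodE // -EM'.
have EX f k : (exists M, eventually_constant f M) ->
    (exists M, eventually_constant (fun t => f t ^+ k) M) /\
    E f ^+ k = E (fun t => f t ^+ k).
  move=> fM; elim: k => [|k [IHe IH]].
    by split; [exists 0%N | rewrite expg0 -E1].
  split; last by rewrite expgS IH -EM' //; congr E; apply: funext => t; rewrite expgS.
  have -> : (fun t => f t ^+ k.+1) = (fun t => f t * f t ^+ k).
    by apply: funext => t; rewrite expgS.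
  exact: ecM.
have E_eq1 f : (exists M, eventually_constant f M) ->
    E f = 1 <-> forall t, f t = 1.
  move=> fM; rewrite -E1; split=> [/(Einj' _ _ fM (cst_ec' 1)) -> //|f1].
  by congr E; apply: funext.
exists u, tau; split.
- move=> i j /(Einj' _ _ (ind_ec _ _) (ind_ec _ _)) /(congr1 (fun f => f i)).
  rewrite /ind !inE eqxx; case: eqP => [//|_ /c1] [].
- move=> i j; rewrite /commute -!EM' //; congr E; apply: funext => t.
  by rewrite /ind !inE; case: ifP => _; case: ifP => _; rewrite ?mulg1 ?mul1g.
- move=> I uI; rewrite seqE //.
  split.
    rewrite -EM' // -E1; congr E; apply: funext => t; rewrite /ind.
    case: ifP => _; last by rewrite mul1g ha.1.
    by rewrite /c !mulgA -(mulgA _ a a) ha.1 mulg1 -(mulgA _ b b) hb.1 mulg1 ha.1.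
  move/(E_eq1 _ (ind_ec' I))/(_ 0%N); rewrite /ind; case: ifP => _.
    move=> e; apply: hb.2; move: e => /(congr1 (fun x => a * x * a)).
    by rewrite /c !mulgA ha.1 mul1g mulg1 -mulgA ha.1 mulg1.
  by rewrite mul1g => /ha.2.
- move=> I J uIJ I0 k; have := uIJ; rewrite cat_uniq => /and3P[uI /hasPn IJ uJ].
  rewrite !seqE // -EM' //.
  have fgE t : ind c I t * a * (ind c J t * a) =
      if t \in I then c else if t \in J then c^-1 else 1.
    rewrite /ind; case: ifPn => tI.
      rewrite ifN; last by apply/negP => /IJ; rewrite tI.
      by rewrite mul1g -mulgA ha.1 mulg1.
    case: ifP => _; last by rewrite !mul1g ha.1.
    rewrite mul1g /c !mulgA ha.1 mul1g invgM (involutionV ha).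
    by rewrite (involutionV hb).
  have fgec : exists M, eventually_constant (fun t => ind c I t * a * (ind c J t * a)) M.
    exact: ecM.
  rewrite (EX _ k fgec).2 (E_eq1 _ (EX _ k fgec).1).
  split=> [H1|ck t].
    case: I I0 {uIJ uI IJ fgec} fgE H1 => // i I _ fgE /(_ i).
    by rewrite fgE mem_head.
  rewrite fgE; case: ifP => _ //; case: ifP => _; last by rewrite expg1n.
  by rewrite expVgn ck invg1.
Qed.

(** * Sign changes *)

(** The number of pairs of distinct consecutive letters. *)
Definition changes (s : seq bool) : nat :=
  if s is b :: s' then sumn (pairmap (fun x y => nat_of_bool (x != y)) b s') else 0.

Lemma changes_negb s : changes (map negb s) = changes s.
Proof.
case: s => [//|b s] /=; elim: s b => [//|c s IH] b /=.
by rewrite IH; case: b c => [] [].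
Qed.

Lemma changes_cat b s c t :
  changes ((b :: s) ++ c :: t) =
  (changes (b :: s) + (last b s != c) + changes (c :: t))%N.
Proof. by rewrite /= pairmap_cat sumn_cat /= addnA. Qed.

(** Complementing the left word if necessary, one decides whether the junction of
    two words contributes a change. *)
Lemma changes_join (s t : seq bool) (k : bool) :
  s != [::] -> (k -> t != [::]) ->
  exists e : bool,
    changes ((if e then map negb s else s) ++ t) = (changes s + k + changes t)%N.
Proof.
case: s => [//|b s] _; case: t => [|c t] kt.
  by exists false; case: k kt => [/(_ isT)//|_]; rewrite cats0 !addn0.
have lastN : last (~~ b) (map negb s) = ~~ last b s.
  by rewrite (last_map negb).
exists ((last b s != c) != k); case: ifP => h.
  rewrite map_cons changes_cat -map_cons changes_negb lastN; congr (_ + _ + _)%N.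
  by case: (last b s) c k h {kt} => [] [] [].
rewrite changes_cat; congr (_ + _ + _)%N.
by case: (last b s) c k h {kt} => [] [] [].
Qed.

Section Signs.
Variables (T : eqType) (code : T -> nat).
Hypothesis code_inj : injective code.
Implicit Types d e : nat -> T.

(** The signs of the comparisons of [d i] with [e i] for [m <= i < n], at the places
    where they differ; [code] is an injection used to order [T]. *)
Definition signs d e (m n : nat) : seq bool :=
  [seq (code (d i) < code (e i))%N | i <- index_iota m n & d i != e i].

Lemma signs_cat d e m n p : (m <= n)%N -> (n <= p)%N ->
  signs d e m p = signs d e m n ++ signs d e n p.
Proof.
move=> mn np; rewrite /signs /index_iota -map_cat -filter_cat; congr map.
by rewrite -{2}(subnKC mn) -iotaD addnC addnBA // subnK.
Qed.

Lemma eq_signs d e d' e' m n :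
  (forall i, (m <= i < n)%N -> d i = d' i /\ e i = e' i) ->
  signs d e m n = signs d' e' m n.
Proof.
move=> H; rewrite /signs.
have -> : [seq i <- index_iota m n | d i != e i] =
          [seq i <- index_iota m n | d' i != e' i].
  by apply: eq_in_filter => i; rewrite mem_index_iota => /H[-> ->].
apply/eq_in_map => i; rewrite mem_filter mem_index_iota => /andP[_ /H[-> ->]].
by [].
Qed.

Lemma signs_swap d e m n : signs e d m n = map negb (signs d e m n).
Proof.
rewrite /signs -map_comp.
have -> : [seq i <- index_iota m n | e i != d i] =
          [seq i <- index_iota m n | d i != e i].
  by apply: eq_filter => i; rewrite eq_sym.
apply/eq_in_map => i; rewrite mem_filter => /andP[de _] /=.
by rewrite -leqNgt ltn_neqAle (inj_eq code_inj) eq_sym de.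
Qed.

Lemma signs_nilP d e m n :
  reflect (forall i, (m <= i < n)%N -> d i = e i) (signs d e m n == [::]).
Proof.
rewrite /signs -size_eq0 size_map size_filter -leqn0 leqNgt -has_count.
apply: (iffP idP) => [/hasPn de i|de].
  by rewrite -mem_index_iota => /de /negPn /eqP.
by apply/hasPn => i; rewrite mem_index_iota => /de ->; rewrite eqxx.
Qed.

End Signs.

(** * Exhaustions and digits *)

(** An increasing sequence of finite subgroups starting from the trivial one, and
    an injective enumeration of [H] compatible with it; in particular the
    subgroups cover [H]. *)
Record exhaustion (H : groupType) := Exhaustion {
  level : nat -> set H;
  level_subgroup : forall n, subgroup_set (level n);
  level_finite : forall n, finite_set (level n);
  level_le : forall m n x, (m <= n)%N -> level m x -> level n x;
  level0 : forall x, level 0 x -> x = 1;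
  code : H -> nat;
  code_inj : injective code;
  level_code : forall n x, (code x < n)%N -> level n x }.

Lemma countable_exhaustion (H : groupType) :
  countable [set: H] -> locally_finite H -> inhabited (exhaustion H).
Proof.
move=> /countable_injP[code code_in] lfH.
have code_inj : injective code by move=> x y; apply: code_in; rewrite inE.
pose X n := [set h : H | (code h < n)%N].
split; apply: (@Exhaustion H (fun n => Defs.generated (X n)) _ _ _ _ code) => //.
- move=> n; split.
  + by move=> K [[K1 _ _] _].
  + move=> x y Lx Ly K SK; have [[_ KM _] _] := SK.
    by apply: KM; [exact: Lx | exact: Ly].
  + by move=> x Lx K SK; have [[_ _ KV] _] := SK; apply: KV; exact: Lx.
- move=> n; apply: lfH; apply: (finite_preimage _ (finite_II n)).
  by move=> x y _ _; exact: code_inj.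
- move=> m n x mn Lx K [SK Kn]; apply: Lx; split=> // y ym; apply: Kn.
  exact: leq_trans ym mn.
- move=> x /(_ [set 1]); apply; split=> //; split=> //.
  + by move=> _ _ -> ->; rewrite /= mulg1.
  + by move=> _ ->; rewrite /= invg1.
- by move=> n x xn K [_]; apply.
Qed.

Section Digits.
Variables (H : groupType) (X : exhaustion H).
Local Notation level := (level X).
Local Notation code := (code X).

Lemma level1 n : level n 1. Proof. by case: (level_subgroup X n). Qed.

Lemma levelM n x y : level n x -> level n y -> level n (x * y).
Proof. by case: (level_subgroup X n) => _ + _; apply. Qed.

Lemma levelV n x : level n x -> level n x^-1.
Proof. by case: (level_subgroup X n) => _ _; apply. Qed.

(** A representative of the left coset of [x] modulo [level n]. *)
Definition rep (n : nat) (x : H) : H := xget 1 [set y | level n (x^-1 * y)].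

Lemma rep_level n x : level n (x^-1 * rep n x).
Proof.
by apply: (@xgetI _ 1 [set y | level n (x^-1 * y)] x); rewrite /= mulVg; exact: level1.
Qed.

Lemma rep_coset n x h : level n h -> rep n (x * h) = rep n x.
Proof.
move=> Lh; congr xget; apply/seteqP; split=> y /=; rewrite invgM -mulgA => Ly.
  by rewrite -[_ * y](mulVKg h); exact: levelM.
by apply: levelM => //; exact: levelV.
Qed.

(** The [n]-th digit of [x], an element of [level n.+1]. *)
Definition digit (x : H) (n : nat) : H := (rep n.+1 x)^-1 * rep n x.

Lemma digit_level n x : level n.+1 (digit x n).
Proof.
have -> : digit x n = (x^-1 * rep n.+1 x)^-1 * (x^-1 * rep n x).
  by rewrite invgM invgK /digit mulgA mulgK.
apply: levelM; first by apply: levelV; exact: rep_level.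
exact: level_le (leqnSn n) (rep_level n x).
Qed.

(** The [n]-th digit depends only on the left coset modulo [level n]. *)
Lemma digit_coset n x h : level n h -> digit (x * h) n = digit x n.
Proof.
move=> Lh; rewrite /digit !rep_coset //.
exact: level_le (leqnSn n) Lh.
Qed.

(** For large [n] the representatives of [x] and [y] are both that of [1], and the
    digits recover the representatives for smaller [n], down to [x] and [y]
    themselves for [n = 0]. *)
Lemma digit_inj x y : digit x =1 digit y -> x = y.
Proof.
move=> xy.
have rep0 z : rep 0 z = z by have /(@level0 _ X) /mulg1_eq := rep_level 0 z; rewrite invgK => <-.
pose n := maxn (code x).+1 (code y).+1.
have rep1 z : (code z < n)%N -> rep n z = rep n 1.
  by move=> zn; rewrite -[z in LHS]mul1g rep_coset //; exact: level_code.
have: rep n x = rep n y by rewrite !rep1 // leq_max ltnSn ?orbT.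
elim: n {rep1} => [|n IH]; first by rewrite !rep0.
by move=> e; apply: IH; apply: (mulgI (rep n.+1 x)^-1); rewrite {2}e; exact: xy.
Qed.

(** The number of sign changes in the comparison of the digits of [x] and [y].
    From the place [(code x + code y).+1] on, both have the digits of [1]. *)
Definition osc (x y : H) : nat :=
  changes (signs code (digit x) (digit y) 0 (code x + code y).+1).

Lemma osc_stable x y n :
  (code x < n)%N -> (code y < n)%N ->
  osc x y = changes (signs code (digit x) (digit y) 0 n).
Proof.
move=> xn yn.
have stable m : (code x < m)%N -> (code y < m)%N -> forall k, (m <= k)%N ->
    signs code (digit x) (digit y) 0 k = signs code (digit x) (digit y) 0 m.
  move=> xm ym k mk; rewrite (signs_cat _ _ _ (leq0n m) mk).
  rewrite [X in _ ++ X](_ : _ = [::]) ?cats0 //; apply/eqP/signs_nilP => i /andP[mi _].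
  rewrite -[x]mul1g -[y]mul1g !digit_coset //; apply: level_code; exact: leq_trans mi.
pose m := maxn n (code x + code y).+1.
rewrite /osc -(stable _ _ _ m) ?leq_maxr ?ltnS ?leq_addr ?leq_addl //.
by rewrite (stable n) // leq_maxl.
Qed.

End Digits.

(** * Ultrafilter limits *)

Section UltrafilterLimit.
Variables (T : choiceType) (U : set_system nat).
Hypothesis ultraU : UltraFilter U.

(** The limit along [U] of a sequence, meaningful if it takes finitely many
    values. *)
Definition ultralim (f : nat -> T) : T := xget (f 0%N) [set v | U [set i | f i = v]].

Lemma ultralimP f (A : set T) : finite_set A -> (forall i, A (f i)) ->
  U [set i | f i = ultralim f].
Proof.
move=> /finite_seqP[s ->] fs.
suff [v Uv] : exists v, U [set i | f i = v].
  exact: (@xgetI _ (f 0%N) [set v' | U [set i | f i = v']] v Uv).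
have : U [set i | f i \in s] by apply: filterS (filterT (F := U)) => i _; exact: fs.
elim: s {fs} => [|v s IH] Us.
  by have [i] := filter_ex Us.
have [|nv] := in_ultra_setVsetC [set i | f i = v] ultraU; first by exists v.
apply: IH; apply: filterS (filterI Us nv) => i /= [].
by rewrite inE => /orP[/eqP|].
Qed.

End UltrafilterLimit.

Lemma nonprincipal_ultrafilter :
  exists U : set_system nat, UltraFilter U /\ forall n, U [set i | (n <= i)%N].
Proof.
have [U [ultraU FU]] := ultraFilterLemma (frechet_properfilter infinite_nat).
exists U; split=> // n; apply: FU.
apply: sub_finite_set (finite_II n) => i /= /negP.
by rewrite -ltnNge.
Qed.

(** * Oscillation of words *)

Section Oscillation.
Variables (H : groupType) (X : exhaustion H).
Variables (v : nat -> H) (theta : H).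
Hypotheses (v_inj : injective v) (v_comm : forall i j, commute (v i) (v j)).
Variable U : set_system nat.
Hypotheses (ultraU : UltraFilter U) (U_cofinal : forall n, U [set i | (n <= i)%N]).

Local Notation level := (level X).
Local Notation code := (code X).
Local Notation digit := (digit X).
Local Notation signs := (signs code).

(** The product of the [v i] for [i] in [I], followed by the fixed element
    [theta]. *)
Definition word (I : seq nat) : H := \prod_(i <- I) v i * theta.

(** The iterated limit of the [n]-th digit of
    [z * v i_1 * ... * v i_s * theta]. *)
Fixpoint limdigit (s : nat) (z : H) (n : nat) : H :=
  if s is s'.+1 then ultralim U (fun i => limdigit s' (z * v i) n)
  else digit (z * theta) n.

Lemma limdigitS s z n :
  level n.+1 (limdigit s z n) /\
  U [set i | limdigit s (z * v i) n = limdigit s.+1 z n].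
Proof.
elim: s z n => [|s IH] z n; first split.
- exact: digit_level.
- apply: (ultralimP ultraU (level_finite X n.+1)) => i.
  exact: digit_level.
have Us : U [set i | limdigit s (z * v i) n = limdigit s.+1 z n] by case: (IH z n).
split.
  by have [i <-] := filter_ex Us; case: (IH (z * v i) n).
apply: (ultralimP ultraU (level_finite X n.+1)) => i.
have [j <-] := filter_ex (IH (z * v i) n).2.
by case: (IH (z * v i * v j) n).
Qed.

(** Almost all [i] realise the limit simultaneously for all [z] in a finite level
    and all places below it. *)
Lemma limdigit_uniform s n0 : U [set i | forall z n, level n0 z -> (n < n0)%N ->
  limdigit s (z * v i) n = limdigit s.+1 z n].
Proof.
have /finite_seqP[zs zsE] := level_finite X n0.
suff : U [set i | forall z, z \in zs -> forall n, (n < n0)%N ->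
    limdigit s (z * v i) n = limdigit s.+1 z n].
  by apply: filterS => i /= H0 z n Lz; apply: H0; move: Lz; rewrite zsE.
elim: zs {zsE} => [|z zs IH]; first by apply: filterS (filterT (F := U)).
suff Uz : U [set i | forall n, (n < n0)%N ->
    limdigit s (z * v i) n = limdigit s.+1 z n].
  by apply: filterS (filterI Uz IH) => i /= [Hz Hzs] z'; rewrite inE => /orP[/eqP ->|/Hzs].
elim: n0 {IH} => [|n0 IH]; first by apply: filterS (filterT (F := U)).
apply: filterS (filterI (limdigitS s z n0).2 IH) => i /= [e He] n.
by rewrite ltnS leq_eqVlt => /orP[/eqP ->|/He].
Qed.

Lemma commute_prod i (I : seq nat) : commute (v i) (\prod_(j <- I) v j).
Proof.
elim: I => [|j I IH]; first by rewrite big_nil; exact: commute1.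
by rewrite big_cons; apply: commuteM.
Qed.

Lemma word_cons i I : word (i :: I) = v i * word I.
Proof. by rewrite /word big_cons mulgA. Qed.

(** High digits do not see the letters of low level, as these can be moved to the
    right end of the word. *)
Lemma digit_word_cons n0 i I n :
  level n0 theta -> level n0 (v i) -> (n0 <= n)%N ->
  digit (word (i :: I)) n = digit (word I) n.
Proof.
move=> Lt Lv n0n.
have -> : word (i :: I) = word I * (theta^-1 * (v i * theta)).
  by rewrite /word big_cons (commute_prod i I) -!mulgA mulVKg.
apply: digit_coset; apply: (level_le n0n).
by apply: levelM; [exact: levelV | exact: levelM].
Qed.

(** With [s] pairs of letters, the number of sign changes from the place [n0] on
    takes [s] consecutive values, starting from some [C]; for [s = 0] only the
    value [C] is claimed.  The words [I] and [J] avoid any prescribed letters, and their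
    digits below [n0], even after a multiplication by [z] in [level n0], have the
    limit values. *)
Lemma interleaved_words s n0 (used : seq nat) : level n0 theta ->
  exists C, forall q, (q <= s.-1)%N -> exists I J : seq nat,
  [/\ uniq (I ++ J) /\ {in I ++ J, forall i, i \notin used}, size I = s,
      forall z n, level n0 z -> (n < n0)%N ->
        digit (z * word I) n = limdigit s z n /\
        digit (z * word J) n = limdigit s z n
    & exists M W, [/\ (forall M', (M <= M')%N -> (n0 <= M')%N /\
           signs (digit (word I)) (digit (word J)) n0 M' = W),
          changes W = (C + q)%N & (0 < s)%N -> W != [::] ] ].
Proof.
elim: s n0 used => [|s IH] n0 used Lt.
  exists 0%N => q; rewrite /= leqn0 => /eqP ->; exists [::], [::]; split=> //.
    by move=> z n _ _; rewrite /word big_nil mul1g.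
  exists n0, [::]; split=> // M' n0M'; split=> //.
  by apply/eqP/signs_nilP => //.
(* The letters in [G] realise the limits at places smaller than [n0]. *)
pose G := [set i | forall z n, level n0 z -> (n < n0)%N ->
  limdigit s (z * v i) n = limdigit s.+1 z n].
have pick (us : seq nat) : exists2 i, i \notin us & G i.
  have UG : U ([set i | \max_(k <- us) k.+1 <= i]%N `&` G).
    by apply: filterI; [exact: U_cofinal | exact: limdigit_uniform].
  have [i [/= ui Gi]] := filter_ex UG.
  exists i => //; apply/negP => iu.
  have := leq_trans (@leq_bigmax_seq _ us xpredT (fun i => i.+1) i iu isT) ui.
  by rewrite ltnn.
have [i iu Gi] := pick used.
have [j jiu Gj] := pick (i :: used).
have ij : j != i by move: jiu; rewrite inE negb_or => /andP[].
have ju : j \notin used by move: jiu; rewrite inE negb_or => /andP[].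
pose n1 := maxn n0 (maxn (code (v i)).+1 (code (v j)).+1).
have n01 : (n0 <= n1)%N by rewrite leq_maxl.
have Li : level n1 (v i).
  by apply: level_code; rewrite /n1 !leq_max ltnSn !orbT.
have Lj : level n1 (v j).
  by apply: level_code; rewrite /n1 !leq_max ltnSn !orbT.
have Lt1 : level n1 theta := level_le n01 Lt.
have [C IHC] := IH n1 (i :: j :: used) Lt1.
(* By the choice of [n1], the places from [n0] to [n1] form the block of the pair
   [(i, j)]; [W] is its sign sequence when [i] is given to [I]. *)
pose W := signs (limdigit s (v i)) (limdigit s (v j)) n0 n1.
(* If [W] were empty, [v i] and [v j] followed by a common word would have the same
   digits everywhere, and hence be equal. *)
have W0 : W != [::].
  apply/signs_nilP => eW; have [I [J [_ _ dIJ _]]] := IHC 0%N (leq0n _).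
  have digE k : level n1 (v k) -> forall n, (n < n1)%N ->
      digit (v k * word I) n = limdigit s (v k) n.
    by move=> Lk n nn1; case: (dIJ (v k) n Lk nn1).
  have eq_lt n : (n < n1)%N -> limdigit s (v i) n = limdigit s (v j) n.
    move=> nn1; case: (ltnP n n0) => nn0; last by apply: eW; rewrite nn0.
    by rewrite -[v i]mul1g -[v j]mul1g Gi ?Gj //; exact: level1.
  have : v i * word I = v j * word I.
    apply: (digit_inj (X := X)) => n; case: (ltnP n n1) => nn1.
      by rewrite !digE ?eq_lt.
    by rewrite -!word_cons !(@digit_word_cons n1).
  by move/mulIg/v_inj => e; move: ij; rewrite e eqxx.
exists (changes W + C)%N => q qs.
(* The new junction contributes a change exactly when [q] is positive. *)
have [|I [J [[uIJ nIJ] sI dIJ [M [W' [sW' cW' W'0]]]]]] := IHC q.-1.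
  by rewrite -!subn1; exact: leq_sub2r.
have [|e ce] := @changes_join W W' (0 < q)%N W0.
  by move=> q0; apply: W'0; apply: leq_trans qs.
pose i' := if e then j else i; pose j' := if e then i else j.
have perm_ij : perm_eq [:: i'; j'] [:: i; j].
  rewrite /i' /j'; case: (e); rewrite ?perm_refl //.
  by rewrite -[[:: j; i]]/([:: j] ++ [:: i]) perm_catC.
have Gi' : G i' by rewrite /i'; case: (e).
have Gj' : G j' by rewrite /j'; case: (e).
have Li' : level n1 (v i') by rewrite /i'; case: (e).
have Lj' : level n1 (v j') by rewrite /j'; case: (e).
exists (i' :: I), (j' :: J).
have perm_IJ : perm_eq ((i' :: I) ++ j' :: J) ([:: i; j] ++ (I ++ J)).
  apply: (@perm_trans _ ([:: i'; j'] ++ (I ++ J))); last by rewrite perm_cat2r.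
  by rewrite /= perm_cons -[j' :: J]/([:: j'] ++ J) perm_catCA perm_refl.
split.
- split.
    rewrite (perm_uniq perm_IJ) cat_uniq uIJ /= !inE (eq_sym i) ij andbT.
    rewrite andbT; apply/hasPn => k /nIJ; rewrite !inE !negb_or => /and3P[ki kj _].
    by rewrite /= ?inE ?negb_or ki kj.
  move=> k; rewrite (perm_mem perm_IJ) mem_cat => /orP[|/nIJ].
    by rewrite !inE => /orP[] /eqP ->.
  by rewrite !inE !negb_or => /and3P[].
- by rewrite /= sI.
- move=> z n Lz nn0; rewrite !word_cons (mulgA z (v i')) (mulgA z (v j')).
  have nn1 := leq_trans nn0 n01; have Lz1 := level_le n01 Lz.
  rewrite (dIJ (z * v i') n _ nn1).1; last exact: levelM.
  rewrite (dIJ (z * v j') n _ nn1).2; last exact: levelM.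
  by rewrite Gi' // Gj'.
- exists M, ((if e then map negb W else W) ++ W'); split.
  + move=> M' MM'; have [n1M' sM'] := sW' M' MM'; split; first exact: leq_trans n1M'.
    rewrite (signs_cat _ _ _ n01 n1M'); congr (_ ++ _).
      have -> : signs (digit (word (i' :: I))) (digit (word (j' :: J))) n0 n1 =
                signs (limdigit s (v i')) (limdigit s (v j')) n0 n1.
        apply: eq_signs => n /andP[_ nn1]; rewrite !word_cons.
        by rewrite (dIJ _ _ Li' nn1).1 (dIJ _ _ Lj' nn1).2.
      by rewrite /i' /j' /W; case: (e) => //; rewrite (signs_swap (@code_inj _ X)).
    rewrite -sM'; apply: eq_signs => n /andP[n1n _].
    by rewrite !(@digit_word_cons n1).
  + rewrite ce cW' addnACA; case: (q) => [|q'] /=; first by rewrite !addn0.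
    by rewrite -!addnA; congr (_ + _)%N; rewrite add1n -addnS addnC.
  + move=> _; rewrite -size_eq0 size_cat addn_eq0 negb_and.
    by rewrite (fun_if size) size_map if_same size_eq0 W0.
Qed.

(** All residues modulo [k] are values of [osc] on pairs of disjoint words. *)
Lemma osc_residue k r : (r < k)%N -> exists I J : seq nat,
  [/\ uniq (I ++ J), (0 < size I)%N & (osc X (word I) (word J) %% k)%N = r].
Proof.
move=> rk; have k0 : (0 < k)%N by exact: leq_ltn_trans rk.
pose n0 := (code theta).+1.
have Lt : level n0 theta by apply: level_code.
have [C HC] := interleaved_words k [::] Lt.
(* Among [k] consecutive values one is congruent to [r]. *)
have [|I [J [[uIJ _] sI dIJ [M [W [sW cW _]]]]]] := HC ((r + (k - C %% k)) %% k)%N.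
  by rewrite -ltnS prednK // ltn_pmod.
exists I, J; split=> //; first by rewrite sI.
pose M' := maxn M (maxn (code (word I)).+1 (code (word J)).+1).
have [n0M' sM'] := sW M' (leq_maxl _ _).
rewrite (@osc_stable _ _ _ _ M'); last 2 first.
- by rewrite /M' !leq_max ltnSn !orbT.
- by rewrite /M' !leq_max ltnSn !orbT.
rewrite (signs_cat _ _ _ (leq0n n0) n0M') sM'.
rewrite [X in X ++ _](_ : _ = [::]) ?cat0s; last first.
  apply/eqP/signs_nilP => n /= nn0; rewrite -[word I]mul1g -[word J]mul1g.
  by have [-> ->] := dIJ 1 n (level1 X n0) nn0.
have Ck : (C %% k <= k)%N by apply: ltnW; rewrite ltn_pmod.
by rewrite cW modnDmr -modnDml addnC -addnA (subnK Ck) modnDr modn_small.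
Qed.

End Oscillation.

(** * Infinite big Ramsey degree from two involutions *)

Lemma big_ramsey_degree_None (A S : groupType) :
  (forall n, ~ ramsey_bound A S n) -> big_ramsey_degree A S = None.
Proof. by move=> unb; apply: xgetPN => t [n [_ /unb]]. Qed.

Lemma involution_emb (A B : groupType) (f : emb A B) x :
  involution x -> involution (f x).
Proof.
move=> [xx x1]; split; first by rewrite -multiplicativeM xx multiplicative1.
by rewrite -(multiplicative1 f) => /(@emb_inj _ _ f).
Qed.

(** A bound [n] is refuted by colouring an embedding [f] with [osc (f a) (f b)]
    modulo [n + 1]: all the [n + 1] colours occur in the image of every [w]. *)
Lemma two_involutions_infinite (H : groupType) (G : finGroupType) (a b : G) :
  hall_universal H -> involution a -> involution b -> a <> b ->
  big_ramsey_degree G H = None.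
Proof.
move=> hH ha hb ab; have [cH lfH univ homog] := hH.
have [X] := countable_exhaustion cH lfH.
have [U [ultraU U_cofinal]] := nonprincipal_ultrafilter.
have [u [tau [u_inj u_comm invol_word word_order]]] := involution_pool hH ha hb ab.
have [f0] := univ G.
apply: big_ramsey_degree_None => n bound.
pose chi (f : emb G H) : 'I_n.+1 := inord (osc X (f a) (f b) %% n.+1).
have [w wn] := bound n.+1 chi (ltn0Sn n).
suff rangeT : range (fun f : emb G H => chi (emb_comp w f)) = setT.
  move: wn; rewrite rangeT -(card_le_eql card_II) card_le_II.
  by rewrite ltnn.
apply/seteqP; split=> // r _.
have wu_inj : injective (w \o u) by apply: inj_comp => //; exact: emb_inj.
have wu_comm i j : commute (w (u i)) (w (u j)) by exact: gmulf_commute.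
have [I [J [uIJ I0 oscIJ]]] := osc_residue X (w tau) wu_inj wu_comm ultraU U_cofinal (ltn_ord r).
have [uI _ uJ] : [/\ uniq I, true & uniq J].
  by move: uIJ; rewrite cat_uniq => /and3P[].
pose x := \prod_(i <- I) u i * tau; pose y := \prod_(j <- J) u j * tau.
have [sigma [/bij_inj sinj sx sy]] :
    exists sigma : {multiplicative H -> H},
    [/\ bijective sigma, sigma (f0 a) = x & sigma (f0 b) = y].
  apply: (@homogeneous_involutions H _ _ _ _ #[a * b]) => //.
  - exact: involution_emb.
  - exact: involution_emb.
  - exact: invol_word.
  - exact: invol_word.
  - by rewrite -multiplicativeM -multiplicativeX expg_order multiplicative1.
  - move=> k; rewrite word_order // -multiplicativeM -multiplicativeX.
    split=> [|->]; last exact: multiplicative1.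
    by rewrite -[X in _ = X -> _](multiplicative1 f0) => /(@emb_inj _ _ f0).
have finj : injective (sigma \o f0) by apply: inj_comp => //; exact: emb_inj.
exists (@Emb G H (sigma \o f0 : {multiplicative G -> H}) finj) => //.
have wword K : w (\prod_(i <- K) u i * tau) = word (w \o u) (w tau) K.
  by rewrite multiplicativeM multiplicative_prod.
apply: val_inj; rewrite /chi /= inordK ?ltn_pmod //.
by rewrite /= sx sy !wword.
Qed.

Lemma involution_order (G : finGroupType) (x : G) : #[x] = 2 -> involution x.
Proof.
move=> x2; split; first by have := expg_order x; rewrite x2.
by move=> x1; move: x2; rewrite x1 order1.
Qed.

(** Distinct involutions are transported from a group to any group that contains a
    copy of it. *)
Lemma embeds_involutions (gT : finGroupType) (K : {group gT}) (G : finGroupType) (x y : gT) :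
  embeds_in K G -> x \in K -> y \in K -> involution x -> involution y -> x <> y ->
  exists a b : G, [/\ involution a, involution b & a <> b].
Proof.
move=> [L /isog_symr /isogP [f finj fK]] xK yK hx hy xy.
have invol z : z \in K -> involution z -> involution (f z).
  move=> zK [zz z1]; split; first by rewrite -morphM // zz morph1.
  by move/eqP; rewrite morph_injm_eq1 // => /eqP.
exists (f x), (f y); split; [exact: invol..|].
by move/(injmP finj) => /(_ xK yK).
Qed.

(** * Involutions in the given groups *)

Lemma dihedral_involutions q : (1 < q)%N ->
  exists x y : 'D_q.*2, [/\ involution x, involution y & x <> y].
Proof.
move=> q1; have /existsP[[x y] /= /eqP[defD x2 y2 _]] := isoGrp_hom (Grp'_dihedral q1).
have small (z : 'D_q.*2) : z ^+ 2 = 1 -> <<[set z]%SET>> <> [set: 'D_q.*2]%SET.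
  move=> z2 e; have : (#[z] <= 2)%N by rewrite dvdn_leq // order_dvdn z2.
  rewrite /order /cycle e card_dihedral //.
  by rewrite -muln2 leqNgt -[X in (X < _)%N]mul1n ltn_mul2r q1.
have inv z : z ^+ 2 = 1 -> z <> 1 -> involution z by rewrite expgS expg1.
exists x, y; split.
- by apply: inv => // x1; apply: (small y y2); rewrite -defD x1 cycle1 joing1G.
- by apply: inv => // y1; apply: (small x x2); rewrite -defD y1 cycle1 joingG1.
- by move=> xy; apply: (small y y2); rewrite -defD xy (joing_idPl (subxx <[y]>)).
Qed.

Lemma Zp_involution n : (0 < n)%N -> ~~ odd n ->
  exists2 z : 'Z_n, z \in Zp n & involution z.
Proof.
move=> n0 en; have n1 : (1 < n)%N by case: n n0 en => [|[]].
exists (inZp n./2); first by rewrite /Zp n1 inE.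
have half : (n./2 + n./2)%N = n by rewrite addnn -[RHS](odd_double_half n) (negPf en).
have lt : (n./2 < n)%N by rewrite -{2}half -{1}[n./2]addn0 ltn_add2l half_gt0.
split; first apply: val_inj.
  by rewrite /= Zp_cast // !modnDm half modnn.
move/(congr1 val) => /=; rewrite Zp_cast // modn_small // => e.
by move: half; rewrite e => e'; move: n0; rewrite -e'.
Qed.

Lemma sym_involutions n : (3 <= n)%N ->
  exists x y : 'S_n, [/\ involution x, involution y & x <> y].
Proof.
case: n => [|[|[|n]]] // _; pose i2 : 'I_n.+3 := inord 2; pose i1 : 'I_n.+3 := inord 1.
have tp (i j : 'I_n.+3) : i != j -> involution (tperm i j).
  move=> ij; split; first exact: tperm2.
  by move/(congr1 (fun s : 'S_n.+3 => s i)); rewrite tpermL perm1 => /eqP; rewrite eq_sym (negPf ij).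
have i01 : ord0 != i1 by rewrite -val_eqE /= inordK.
have i02 : ord0 != i2 by rewrite -val_eqE /= inordK.
have i12 : i1 != i2 by rewrite -val_eqE /= !inordK.
exists (tperm ord0 i1), (tperm ord0 i2); split; [exact: tp..|].
by move/(congr1 (fun s : 'S_n.+3 => s ord0)); rewrite !tpermL => /eqP; rewrite (negPf i12).
Qed.

Local Close Scope classical_set_scope.
Local Close Scope card_scope.
Local Close Scope group_scope.

Theorem corollary4p4 (H : groupType) (hH : hall_universal H) :
  [/\ (* (a) *)
      forall (G : finGroupType) (m : nat), (0 < m)%N ->
        embeds_in 'D_((4 * m)%N)%G G -> big_ramsey_degree G H = None,
      (* (b) *)
      forall G : finGroupType,
        embeds_in (setX_group (Zp_group 2) (Zp_group 2)) G ->
        big_ramsey_degree G H = None,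
      (* (c) *)
      forall (k : nat) (n : 'I_k -> nat) (A : finGroupType),
        (forall i, 0 < n i)%N ->
        [set: A] \isog setXn_group (fun i => Zp_group (n i)) ->
        (exists i j : 'I_k, [/\ i != j, ~~ odd (n i) & ~~ odd (n j)]) ->
        big_ramsey_degree A H = None
    & (* (d) *)
      forall n : nat, (3 <= n)%N -> big_ramsey_degree 'S_n H = None].
Proof.
have embeds (gT : finGroupType) (K : {group gT}) (G : finGroupType) (x y : gT) :
    embeds_in K G -> x \in K -> y \in K -> involution x -> involution y -> x <> y ->
    big_ramsey_degree G H = None.
  move=> KG xK yK hx hy xy.
  have [a [b [ha hb ab]]] := embeds_involutions KG xK yK hx hy xy.
  exact: two_involutions_infinite hH ha hb ab.
split.
- move=> G m m0; have -> : (4 * m)%N = (2 * m).*2 by rewrite -mul2n mulnA.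
  have m1 : (1 < 2 * m)%N by rewrite (leq_mul (leqnn 2) m0).
  have [x [y [hx hy xy]]] := dihedral_involutions m1.
  by move=> DG; apply: (embeds _ _ _ x y DG); rewrite ?finset.in_setT.
- have [z zZ [zz z1]] := @Zp_involution 2 isT isT.
  move=> G ZG; apply: (embeds _ _ _ (z, 1%g) (1%g, z) ZG).
  + by rewrite inE /= zZ group1.
  + by rewrite inE /= zZ group1.
  + by split; [congr (_, _); rewrite ?mulg1 | case].
  + by split; [congr (_, _); rewrite ?mulg1 | case].
  + by case.
- move=> k n A n0 isoA [i [j [ij ei ej]]].
  have emb_A : embeds_in (setXn_group (fun i => Zp_group (n i))) A.
    by exists [set: A]%G.
  pose e t (z : 'Z_(n t)) : {dffun forall i, 'Z_(n i)} := dfung1 z.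
  have eP t : ~~ odd (n t) -> exists2 z : 'Z_(n t), z <> 1%g &
      (e t z \in setXn_group (fun i => Zp_group (n i))) /\ involution (e t z).
    move=> et; have [z zZ [zz z1]] := Zp_involution (n0 t) et.
    exists z => //; split.
      rewrite in_setXn; apply/forallP => l; have [<-|tl] := eqVneq t l.
        by rewrite dfung1_id.
      by rewrite dfung1_dflt // group1.
    split.
      rewrite /e -dfung1_morphM zz; apply/ffunP => l; rewrite oneg_ffun.
      by have [<-|tl] := eqVneq t l; [rewrite dfung1_id | rewrite dfung1_dflt].
    by move/(congr1 (fun f : {dffun forall i, 'Z_(n i)} => f t)); rewrite dfung1_id ffunE.
  have [x x1 [xX hx]] := eP i ei; have [y y1 [yX hy]] := eP j ej.
  apply: (embeds _ _ _ _ _ emb_A xX yX hx hy) => exy.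
  apply: x1; have := congr1 (fun f : {dffun forall i, 'Z_(n i)} => f i) exy.
  by rewrite dfung1_id dfung1_dflt // eq_sym.
- move=> n /sym_involutions[x [y [hx hy xy]]].
  exact: two_involutions_infinite hH hx hy xy.
Qed.
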